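(* Let $m\ge 2$ be an integer, and let $$G_m=\sum_{\mathfrak f}\ x_0^{\mathfrak f_0}x_1^{\mathfrak f_1}\cdots x_m^{\mathfrak f_m},$$ where the sum is over all $\mathfrak f\in\mathbb N^{m+1}$ for which there exists a DS-system $\Phi\subset\mathbf 2^{[m]}$ with $f(\Phi;m)=\mathfrak f$ (each such $\mathfrak f$ occurring once). (i) If $m$ is even, then $$G_m=-1+(1+x_0)\sum_{\beta}x_1^{\beta_1}\cdots x_m^{\beta_m}+\sum_{\gamma}x_0^{\gamma_0}\cdots x_{m-1}^{\gamma_{m-1}},$$ where the first sum is over all $\beta=(\beta_1,\dots,\beta_m)$ with $(0,\beta)\in\mathcal P^{\mathrm f}(m)\cap\mathbb N^{m+1}$, and the second sum is over all $\gamma=(\gamma_0,\dots,\gamma_{m-1})$ with $(\gamma,0,0)\in\mathcal Q^{\mathrm f}(m+1)\cap\mathbb N^{m+2}$ and $\gamma\le\bigl(\binom m0,\binom m1,\dots,\binom m{m-1}\bigr)$ componentwise. (ii) If $m$ is odd, then $$G_m=-1+\sum_{\beta}x_0^{\beta_0}\cdots x_{m-2}^{\beta_{m-2}}+(1+x_0)\sum_{\gamma}x_1^{\gamma_1}\cdots x_{m-1}^{\gamma_{m-1}},$$ where the first sum is over all $\beta=(\beta_0,\dots,\beta_{m-2})$ with $(\beta,0,0)\in\mathcal Q^{\mathrm f}(m)\cap\mathbb N^{m+1}$, and the second sum is over all $\gamma=(\gamma_1,\dots,\gamma_{m-1})$ with $(0,\gamma,0,0)\in\mathcal P^{\mathrm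 f}(m+1)\cap\mathbb N^{m+2}$ and $\gamma\le\bigl(\binom m1,\binom m2,\dots,\binom m{m-1}\bigr)$ componentwise.
   Context: Vectors are row vectors; components of vectors and rows/columns of matrices are indexed from $0$; $\mathbb N=\{0,1,2,\dots\}$; inequalities between vectors are componentwise. $[m]=\{1,\dots,m\}$ and $\mathbf 2^{[m]}$ is the family of all subsets of $[m]$. A face system is any family $\Phi\subseteq\mathbf 2^{[m]}$; $\#\Phi$ is its number of members; if $\#\Phi>0$ its size is $d(\Phi)=\max_{F\in\Phi}|F|$. Long $f$-vector: $f(\Phi;m)=(f_0(\Phi;m),\dots,f_m(\Phi;m))\in\mathbb N^{m+1}$ with $f_i(\Phi;m)=\#\{F\in\Phi:|F|=i\}$. Long $h$-vector: $h(\Phi;m)\in\mathbb Z^{m+1}$ is defined by $\sum_{i=0}^m h_i(\Phi;m)\,y^{m-i}=\sum_{i=0}^m f_i(\Phi;m)\,(y-1)^{m-i}$. A face system $\Phi\subset\mathbf 2^{[m]}$ is a DS-system if $h_l(\Phi;m)=(-1)^{m-d(\Phi)}h_{m-l}(\Phi;m)$ for all $0\le l\le m$. The empty face system ($\#\Phi=0$), for which $f(\Phi;m)=h(\Phi;m)=0$, counts as a DS-system. For an integer $n\ge 2$, $\mathbf I(n)$ is the $(n+1)\times(n+1)$ identity matrix and $\mathbf D(n)$ is the $(n+1)\times(n+1)$ matrix with $(i,j)$ entry $(-1)^{n-i}\binom ij$ (with $\binom ij=0$ for $j>i$). Put $\mathcal E^{\mathrm f}(n)=\{z\in\mathbb R^{n+1}:z\,\mathbf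 D(n)=z\}$. The polytope $\mathcal Q^{\mathrm f}(n)$ is $$\mathcal Q^{\mathrm f}(n)=\Bigl\{x\in\mathbb R^{n+1}:\ x\cdot(\mathbf I(n)-\mathbf D(n))=0,\ 0\le x\le\bigl(\tbinom n0,\tbinom n1,\dots,\tbinom nn\bigr)\Bigr\},$$ and for even $n$ the polytope $\mathcal P^{\mathrm f}(n)$ is $$\mathcal P^{\mathrm f}(n)=\mathcal E^{\mathrm f}(n)\cap\Bigl\{z\in\mathbb R^{n+1}:\ z_0=0,\ 0\le(z_1,\dots,z_n)\le\bigl(\tbinom n1,\tbinom n2,\dots,\tbinom nn\bigr)\Bigr\}.$$ *)

(* Defs.v *)
From HB Require Import structures.
From mathcomp Require Import all_boot all_order all_algebra.
From mathcomp Require Import classical_sets fsbigop reals.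
From mathcomp Require Export mpoly.

Set Implicit Arguments.
Unset Strict Implicit.
Unset Printing Implicit Defensive.

Import Order.TTheory GRing.Theory Num.Theory.
Local Open Scope classical_set_scope.
Local Open Scope ring_scope.

(* The ground set {1, ..., m} is 'I_m, so a face system is a {set {set 'I_m}}. *)

(* The maximum over the empty system is 0; [DS_system] treats that system
   separately, so the value is never used. *)
Definition fs_size (m : nat) (Phi : {set {set 'I_m}}) : nat :=
  \max_(F in Phi) #|F|.

Definition fvec (m : nat) (Phi : {set {set 'I_m}}) : m.+1.-tuple nat :=
  [tuple #|[set F in Phi | #|F| == i]%SET| | i < m.+1].

Definition hgen (m : nat) (Phi : {set {set 'I_m}}) : {poly int} :=
  \sum_(i < m.+1) (tnth (fvec Phi) i)%:R *: ('X - 1) ^+ (m - i).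

(* h_l is the coefficient of y^(m-l) in [hgen]; see [hvecE] and
   [hvec_uniq] below. *)
Definition hvec (m : nat) (Phi : {set {set 'I_m}}) : 'rV[int]_m.+1 :=
  \row_(l < m.+1) (hgen Phi)`_(m - l).

Definition DS_system (m : nat) (Phi : {set {set 'I_m}}) : Prop :=
  Phi = finset.set0 \/
  forall l : 'I_m.+1,
    hvec Phi 0 l = (-1) ^+ (m - fs_size Phi) * hvec Phi 0 (rev_ord l).

Lemma hvec_uniq (m : nat) (Phi : {set {set 'I_m}}) (h : 'rV[int]_m.+1) :
  \sum_(i < m.+1) h 0 i *: 'X^(m - i) = hgen Phi -> h = hvec Phi.
Proof.
move=> Eh; apply/rowP => l; rewrite mxE -Eh coef_sum (bigD1 l) //=.
rewrite coefZ coefXn eqxx mulr1 big1 ?addr0 // => i neq_il.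
rewrite coefZ coefXn; case: eqP => [E|]; last by rewrite mulr0.
case/negP: neq_il; apply/eqP/val_inj => /=.
by rewrite -(subKn (leq_ord i)) -E subKn ?leq_ord.
Qed.

Lemma hvecE (m : nat) (Phi : {set {set 'I_m}}) :
  \sum_(i < m.+1) hvec Phi 0 i *: 'X^(m - i) =
  \sum_(i < m.+1) (tnth (fvec Phi) i)%:R *: ('X - 1) ^+ (m - i) :> {poly int}.
Proof.
rewrite -/(hgen Phi) (reindex_inj rev_ord_inj) /=.
under eq_bigr => i _.
  rewrite mxE /= subSS (subKn (leq_ord i)); over.
rewrite -(@poly_def _ m.+1 (fun i => (hgen Phi)`_i)).
apply/polyP => k; rewrite coef_poly; case: ltnP => // lt_mk.
rewrite nth_default //; apply: leq_trans lt_mk.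
apply: (leq_trans (size_sum _ _ _)); apply/bigmax_leqP => i _.
apply: (leq_trans (size_scale_leq _ _)).
by rewrite -[1]/(1%:P) size_exp_XsubC ltnS leq_subr.
Qed.

(* Matrices act on row vectors from the right: z *m A. *)
Definition Dmx (R : realType) (n : nat) : 'M[R]_n.+1 :=
  \matrix_(i < n.+1, j < n.+1) ((-1) ^+ (n - i) * 'C(i, j)%:R).

Definition Ef (R : realType) (n : nat) : set 'rV[R]_n.+1 :=
  [set z : 'rV[R]_n.+1 | z *m Dmx R n = z].
Arguments Ef : clear implicits.

Definition Qf (R : realType) (n : nat) : set 'rV[R]_n.+1 :=
  [set x : 'rV[R]_n.+1 | x *m (1%:M - Dmx R n) = 0 /\
           forall j : 'I_n.+1, 0 <= x 0 j <= 'C(n, j)%:R].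
Arguments Qf : clear implicits.

Definition Pf (R : realType) (n : nat) : set 'rV[R]_n.+1 :=
  Ef R n `&` [set z : 'rV[R]_n.+1 | z 0 ord0 = 0 /\
     forall j : 'I_n.+1, (1 <= j)%N -> 0 <= z 0 j <= 'C(n, j)%:R].
Arguments Pf : clear implicits.

(* The natural vector s, of length k, seen in R^k. A plain sequence is used so
   that padded vectors such as (g, 0, 0) need no cast on their length. *)
Definition natvec (R : realType) (k : nat) (s : seq nat) : 'rV[R]_k :=
  \row_(j < k) (nth 0%N s j)%:R.

(* The variable x_i, for i <= m. *)
Definition xvar (m i : nat) : {mpoly int[m.+1]} := 'X_(inord i).

(* The sums \sum_(_ \in A) over infinite index types are finitely supported
   sums; every A used is finite, as its members are bounded componentwise by
   binomial coefficients. *)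
Definition DS_genfun (m : nat) : {mpoly int[m.+1]} :=
  \sum_(f \in [set f : m.+1.-tuple nat |
                exists Phi : {set {set 'I_m}}, DS_system Phi /\ fvec Phi = f])
    \prod_(i < m.+1) xvar m i ^+ tnth f i.

(* Main.v *)
(* Put F(s) = sum_i f_i s^i. The h-polynomial is the degree-m reversal of F
   translated by -1, and reversing it corresponds to substituting -1 - s in
   F; hence Phi is a DS-system exactly when F(s) = (-1)^d F(-1-s) with d =
   deg F. The leading coefficient forces this sign, so the condition on d
   can be dropped: the f-vectors of DS-systems are the vectors 0 <= f_i <=
   binom(m, i) with F(s) = F(-1-s) or F(s) = -F(-1-s), and only f = 0
   satisfies both, whence the term -1. On the other side z D(n) = z says
   F(s) = (-1)^n F(-1-s). In the symmetric case f_0 is free, being added to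
   F as a constant, which gives the factor 1 + x_0. The remaining zero
   coordinates come from comparing coefficients: f_m = 0 if the sign differs
   from (-1)^m, and in the antisymmetric case with m odd, 2 f_{m-1} = m f_m
   with f_m <= 1 forces f_m = f_{m-1} = 0. *)
Require Import Defs.
From HB Require Import structures.
From mathcomp Require Import all_boot all_order all_algebra.
From mathcomp Require Import classical_sets fsbigop reals.
From mathcomp Require Import boolp functions cardinality zify.

Set Implicit Arguments.
Unset Strict Implicit.
Unset Printing Implicit Defensive.

Import Order.TTheory GRing.Theory Num.Theory.
Local Open Scope classical_set_scope.
Local Open Scope ring_scope.

(** * Reversal of the coefficients of a polynomial *)

Section Reversal.
Variable K : comNzRingType.
Implicit Types (p q : {poly K}) (a b : K) (m n k : nat).

Definition revp m p : {poly K} := \poly_(i < m.+1) p`_(m - i).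

Lemma coef_revp m p i : (revp m p)`_i = if (i <= m)%N then p`_(m - i) else 0.
Proof. by rewrite coef_poly ltnS. Qed.

Lemma revpK m p : (size p <= m.+1)%N -> revp m (revp m p) = p.
Proof.
move=> szp; apply/polyP => i; rewrite !coef_revp leq_subr.
case: leqP => [/subKn-> // | lt_mi].
by rewrite nth_default // (leq_trans szp).
Qed.

Lemma revpZ m a p : revp m (a *: p) = a *: revp m p.
Proof.
by apply/polyP => i; rewrite coefZ !coef_revp coefZ; case: ifP; rewrite ?mulr0.
Qed.

Lemma revp_sum m (I : Type) (r : seq I) (c : I -> K) (F : I -> {poly K}) :
  revp m (\sum_(i <- r) c i *: F i) = \sum_(i <- r) c i *: revp m (F i).
Proof.
elim: r => [|x r IHr].
  by apply/polyP => i; rewrite !big_nil coef_revp !coef0 if_same.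
rewrite !big_cons -IHr -revpZ; apply/polyP => i.
by rewrite coefD !coef_revp coefD; case: ifP; rewrite ?addr0.
Qed.

(** Reversal is multiplicative when the reference degrees add up, and a + bX reversed in degree 1 is
    b + aX. *)
Lemma revp_mul_lin m p a b : (size p <= m.+1)%N ->
  revp m.+1 (p * (a%:P + b *: 'X)) = revp m p * (b%:P + a *: 'X).
Proof.
move=> szp; have coef_lin q (c d : K) i :
    (q * (c%:P + d *: 'X))`_i = q`_i * c + (if i is j.+1 then q`_j * d else 0).
  rewrite mulrDr coefD coefMC -scalerAr coefZ coefMX.
  by congr (_ + _); case: i => [|i] /=; rewrite ?mulr0 // mulrC.
apply/polyP => i; rewrite coef_revp !coef_lin !coef_revp.
have p0 j : (m < j)%N -> p`_j = 0.
  by move=> ltmj; rewrite nth_default // (leq_trans szp).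
case: i => [|i]; first by rewrite !subn0 /= p0 // mul0r add0r addr0.
rewrite subSS ltnS coef_revp; case: (ltngtP i m) => [lt_im | lt_mi | ->].
- have -> : (m - i = (m - i.+1).+1)%N by lia.
  by rewrite addrC.
- by rewrite !mul0r addr0.
- by rewrite subnn /= addr0 mul0r add0r.
Qed.

Lemma size_lin_exp a b k : (size ((a%:P + b *: 'X) ^+ k)%R <= k.+1)%N.
Proof.
have szl : (size (a%:P + b *: 'X)%R <= 2)%N.
  apply: (leq_trans (size_polyD _ _)); rewrite geq_max size_polyC.
  by rewrite (leq_trans (size_scale_leq _ _)) ?size_polyX //; case: eqP.
apply: (leq_trans (size_poly_exp_leq _ _)); rewrite ltnS -{2}[k]mul1n leq_mul2r.
by apply/orP; right; case: (size _) szl.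
Qed.

Lemma revp_lin_exp a b k n :
  revp (k + n) ((a%:P + b *: 'X) ^+ k) = (b%:P + a *: 'X) ^+ k * 'X^n.
Proof.
elim: n => [|n IHn].
  rewrite addn0 mulr1; elim: k => [|k IHk].
    apply/polyP => i; rewrite !expr0 coef_revp !coef1.
    by case: i => //= i; rewrite if_same.
  by rewrite !exprSr revp_mul_lin ?size_lin_exp // IHk.
(* Each surplus degree is a factor 1 = 1 + 0 X, whose reversal is X. *)
rewrite addnS; have := @revp_mul_lin (k + n) ((a%:P + b *: 'X) ^+ k) 1 0.
rewrite scale0r addr0 scale1r add0r mulr1 => ->; last first.
  by apply: (leq_trans (size_lin_exp _ _ _)); rewrite ltnS leq_addr.
by rewrite IHn -mulrA -exprSr.
Qed.

End Reversal.

(** * The f-polynomial, the reflection s -> -1 - s and the matrix D(n) *)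

Definition fpoly (s : seq nat) : {poly int} :=
  \poly_(i < size s) (nth 0%N s i)%:R.

Definition reflsym (e : nat) (p : {poly int}) : Prop :=
  p = (-1) ^+ e *: (p \Po (-1 - 'X)).

Lemma size_fpoly s : (size (fpoly s) <= size s)%N.
Proof. exact: size_poly. Qed.

Lemma coef_fpoly s i : (fpoly s)`_i = (nth 0%N s i)%:R.
Proof. by rewrite coef_poly; case: ltnP => // szs; rewrite nth_default. Qed.

Lemma fpolyE n s : (size s <= n)%N ->
  fpoly s = \sum_(i < n) (nth 0%N s i)%:R *: 'X^i.
Proof.
move=> szs; rewrite -(@poly_def _ n (fun i => (nth 0%N s i)%:R)).
apply/polyP=> i; rewrite coef_fpoly coef_poly; case: ltnP => // le_ni.
by rewrite nth_default // (leq_trans szs).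
Qed.

Lemma comp_fpolyE n s q : (size s <= n)%N ->
  fpoly s \Po q = \sum_(i < n) (nth 0%N s i)%:R *: q ^+ i.
Proof.
move=> szs; rewrite (fpolyE szs) raddf_sum /=; apply: eq_bigr => i _.
by rewrite linearZ /= comp_Xn_poly.
Qed.

Lemma coef_XD1_exp (K : nzRingType) i j :
  (('X + 1 : {poly K}) ^+ i)`_j = 'C(i, j)%:R.
Proof.
have -> : ('X + 1 : {poly K}) ^+ i = \poly_(k < i.+1) 'C(i, k)%:R.
  by rewrite exprD1n poly_def; apply: eq_bigr => k _; rewrite scaler_nat.
by rewrite coef_poly ltnS; case: leqP => // /bin_small ->.
Qed.

Lemma coef_comp_refl n s j : (size s <= n)%N ->
  (fpoly s \Po (-1 - 'X))`_j =
  \sum_(i < n) (nth 0%N s i)%:R * ((-1) ^+ i * 'C(i, j)%:R).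
Proof.
move=> szs; rewrite (comp_fpolyE _ szs) coef_sum; apply: eq_bigr => i _.
have -> : -1 - 'X = (-1) *: ('X + 1) :> {poly int}.
  by rewrite scaleN1r opprD addrC.
by rewrite exprZn !coefZ coef_XD1_exp.
Qed.

Lemma size_refl : size (-1 - 'X : {poly int}) = 2%N.
Proof. by rewrite -opprD size_polyN addrC size_XaddC. Qed.

(** Up to the global sign (-1)^n, row i of D(n) lists the coefficients of (-1 - s)^i, so D(n) acts
    on coefficient vectors as the signed reflection. *)
Lemma natvec_Dmx (R : realType) n s : (size s <= n.+1)%N ->
  natvec R n.+1 s *m Dmx R n = natvec R n.+1 s <-> reflsym n (fpoly s).
Proof.
move=> szs.
have coefE j : (natvec R n.+1 s *m Dmx R n) 0 j =
    (((-1) ^+ n *: (fpoly s \Po (-1 - 'X)))`_j)%:~R.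
  rewrite coefZ (coef_comp_refl _ szs) mulr_sumr rmorph_sum mxE.
  apply: eq_bigr => i _; rewrite !mxE !rmorphM /= !rmorphXn /= rmorphN1.
  rewrite !rmorph_nat.
  rewrite [RHS]mulrCA; congr (_ * _); rewrite mulrA -exprD; congr (_ * _).
  by rewrite -signr_odd -[RHS]signr_odd oddB ?oddD // leq_ord.
split => [E | E].
  apply/polyP => j; rewrite coef_fpoly; case: (ltnP j n.+1) => [ltjn | lenj].
    apply/(@intr_inj R); rewrite -(coefE (Ordinal ltjn)) E mxE /=.
    by rewrite rmorph_nat.
  rewrite nth_default ?(leq_trans szs) // coefZ nth_default ?mulr0 //.
  rewrite (size_comp_poly2 _ size_refl) (leq_trans (size_fpoly s)) //.
  exact: leq_trans lenj.
apply/rowP => j; rewrite coefE -E coef_fpoly mxE /=; exact: rmorph_nat.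
Qed.

Lemma reflsym_odd e p : reflsym (odd e) p <-> reflsym e p.
Proof. by rewrite /reflsym signr_odd. Qed.

(** The reflection multiplies the leading coefficient by (-1)^deg p, so a nonzero polynomial has at
    most one symmetry sign. *)
Lemma reflsym_sign e p : p != 0 -> reflsym e p -> odd e = odd (size p).-1.
Proof.
move=> p0 /(congr1 lead_coef); rewrite lead_coefZ lead_coef_comp ?size_refl //.
have -> : lead_coef (-1 - 'X : {poly int}) = -1.
  by rewrite -opprD lead_coefN addrC lead_coefXaddC.
rewrite mulrCA -exprD -{1}[lead_coef p]mulr1 => /mulfI; rewrite lead_coef_eq0.
move/(_ p0)/eqP; rewrite -signr_odd oddD; by case: (odd e); case: odd.
Qed.

(** * The h-vector symmetry as a reflection symmetry of F *)

Lemma hgenE m (Phi : {set {set 'I_m}}) :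
  hgen Phi = revp m (fpoly (fvec Phi)) \Po ('X - 1).
Proof.
rewrite (@fpolyE m.+1) ?size_tuple // revp_sum raddf_sum /=.
apply: eq_bigr => i _; rewrite linearZ /= (tnth_nth 0%N).
have -> : revp m 'X^i = 'X^(m - i) :> {poly int}.
  have := revp_lin_exp (0 : int) 1 i (m - i).
  by rewrite subnKC ?leq_ord // add0r !scale1r scale0r addr0 expr1n mul1r.
by rewrite comp_Xn_poly.
Qed.

(** Term by term: (y - 1)^(m-i) reverses to (1 - y)^(m-i) y^i, which at y + 1 is (-y)^(m-i) (y +
    1)^i. This is (-1)^m times the reversal of (-1 - y)^i. *)
Lemma revp_hgenE m (Phi : {set {set 'I_m}}) :
  revp m (hgen Phi) \Po ('X + 1) =
  (-1) ^+ m *: revp m (fpoly (fvec Phi) \Po (-1 - 'X)).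
Proof.
rewrite (@comp_fpolyE m.+1) ?size_tuple // /hgen !revp_sum raddf_sum /=.
rewrite scaler_sumr; apply: eq_bigr => i _.
rewrite linearZ /= (tnth_nth 0%N) scalerA mulrC -scalerA; congr (_ *: _).
have := revp_lin_exp (-1 : int) 1 (m - i) i.
have := revp_lin_exp (-1 : int) (-1) i (m - i).
rewrite subnK ?subnKC ?leq_ord // scale1r scaleN1r polyCN polyC1.
rewrite ['X - 1]addrC => -> ->.
rewrite rmorphM /= !rmorphXn /= rmorphD /= rmorphN /= !comp_polyX rmorph1.
have -> : 1 - ('X + 1) = - 'X :> {poly int} by rewrite opprD addrCA subrr addr0.
have -> : (-1) ^+ m = (-1) ^+ (m - i) * (-1) ^+ i :> int.
  by rewrite -exprD subnK ?leq_ord.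
rewrite -scalerA [(-1) ^+ i *: _]scalerAl -exprZn scaleN1r opprD !opprK.
by rewrite scalerAr -exprZn scaleN1r mulrC ['X + 1]addrC.
Qed.

Lemma size_hgen m (Phi : {set {set 'I_m}}) : (size (hgen Phi) <= m.+1)%N.
Proof.
by rewrite hgenE size_comp_poly2 ?size_XsubC // size_poly.
Qed.

(** Exchanging h_l and h_{m-l} reverses [hgen Phi]. After the shift y -> y + 1 the two sides become
    reversals of F(s) and of F(-1 - s), and reversal is injective in degree at most m. *)
Lemma hvec_symP m (Phi : {set {set 'I_m}}) d : (d <= m)%N ->
  (forall l, hvec Phi 0 l = (-1) ^+ (m - d) * hvec Phi 0 (rev_ord l)) <->
  reflsym d (fpoly (fvec Phi)).
Proof.
move=> ledm; have szP : (size (fpoly (fvec Phi)) <= m.+1)%N.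
  by have := size_fpoly (fvec Phi); rewrite size_tuple.
have szR : (size (fpoly (fvec Phi) \Po (-1 - 'X)) <= m.+1)%N.
  by rewrite (size_comp_poly2 _ size_refl).
(* The sign (-1)^m comes from [revp_hgenE]. *)
have signE : (-1) ^+ (m - d) * (-1) ^+ m = (-1) ^+ d :> int.
  by rewrite -exprD -signr_odd oddD oddB // addbAC addbb -[RHS]signr_odd.
have hgen_shift : hgen Phi \Po ('X + 1) = revp m (fpoly (fvec Phi)).
  rewrite hgenE -comp_polyA comp_polyB comp_polyX comp_polyC addrK.
  exact: comp_polyXr.
have shift_inj (p q : {poly int}) : p \Po ('X + 1) = q \Po ('X + 1) -> p = q.
  by move=> E; rewrite -[p](@comp_polyXaddC_K _ _ 1) E comp_polyXaddC_K.
have -> :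
    (forall l, hvec Phi 0 l = (-1) ^+ (m - d) * hvec Phi 0 (rev_ord l)) <->
    hgen Phi = (-1) ^+ (m - d) *: revp m (hgen Phi).
  split=> [hsym | E l].
    apply/polyP => j; rewrite coefZ coef_revp.
    case: leqP => [lejm | ltmj]; last first.
      by rewrite nth_default ?mulr0 // (leq_trans (size_hgen _)).
    have := hsym (inord (m - j)); rewrite !mxE /= inordK ?ltnS ?leq_subr //.
    by rewrite !subKn // leq_subr.
  rewrite !mxE /= {1}E coefZ coef_revp leq_subr subKn ?leq_ord //.
split=> [/(congr1 (fun p => p \Po ('X + 1))) | E].
  rewrite hgen_shift comp_polyZ revp_hgenE scalerA signE => E.
  by rewrite /reflsym -[LHS](revpK szP) E revpZ revpK.
apply: shift_inj; rewrite hgen_shift comp_polyZ revp_hgenE scalerA signE.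
by rewrite -revpZ -E.
Qed.

(** * Realizable f-vectors and the characterization of DS-systems *)

Lemma tnth_fvec_le m (Phi : {set {set 'I_m}}) i :
  (tnth (fvec Phi) i <= 'C(m, i))%N.
Proof.
have := card_draws 'I_m i; rewrite card_ord tnth_mktuple => <-.
apply: subset_leq_card.
by apply/fintype.subsetP => F; rewrite !inE => /andP[].
Qed.

(** A face system need not be closed under subsets, so the sizes are independent: for each k, take
    the first f_k of the k-subsets in their enumeration. *)
Lemma fvec_onto m (f : m.+1.-tuple nat) :
  (forall i, (tnth f i <= 'C(m, i))%N) ->
  exists Phi : {set {set 'I_m}}, fvec Phi = f.
Proof.
move=> lef; pose draws k := [set F : {set 'I_m} | #|F| == k]%SET.
pose Phi := [set F : {set 'I_m} |
  F \in take (nth 0%N f #|F|) (enum (draws #|F|))]%SET.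
exists Phi; apply: eq_from_tnth => i; rewrite tnth_mktuple (tnth_nth 0%N).
have -> : [set F in Phi | #|F| == i]%SET =
          [set F in take (nth 0%N f i) (enum (draws i))]%SET.
  apply/setP => F; rewrite !inE; apply/andP/idP => [[+ /eqP EF] | Ft].
    by rewrite EF.
  suff EF : #|F| = i by rewrite EF.
  by have := mem_take Ft; rewrite mem_enum inE => /eqP.
have /card_uniqP uniq_take : uniq (take (nth 0%N f i) (enum (draws i))).
  by rewrite take_uniq ?enum_uniq.
rewrite cardsE uniq_take size_takel // -cardE card_draws card_ord.
by rewrite -tnth_nth.
Qed.

Lemma leq_fs_size m (Phi : {set {set 'I_m}}) F :
  F \in Phi -> (#|F| <= fs_size Phi)%N.
Proof. by move=> FPhi; rewrite /fs_size (bigD1 F) //= leq_maxl. Qed.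

Lemma fs_size_le m (Phi : {set {set 'I_m}}) : (fs_size Phi <= m)%N.
Proof. by apply/bigmax_leqP => F _; have := max_card F; rewrite card_ord. Qed.

Lemma nth_fvec m (Phi : {set {set 'I_m}}) i : (i <= m)%N ->
  nth 0%N (fvec Phi) i = #|[set F in Phi | #|F| == i]%SET|.
Proof.
rewrite -ltnS => lti.
by rewrite -[i in nth _ _ i]/(val (Ordinal lti)) -tnth_nth tnth_mktuple.
Qed.

(** Identifies d(Phi) with the degree of F, so that [reflsym_sign] applies to the sign in the DS
    condition. *)
Lemma size_fpoly_fvec m (Phi : {set {set 'I_m}}) : Phi != finset.set0 ->
  size (fpoly (fvec Phi)) = (fs_size Phi).+1.
Proof.
case/set0Pn => F0 F0Phi.
have [F FPhi EF] : {F | F \in Phi & fs_size Phi = #|F|}.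
  by apply: eq_bigmax_cond; apply/card_gt0P; exists F0.
apply/eqP; rewrite eqn_leq; apply/andP; split.
  apply/leq_sizeP => j ltj; rewrite coef_fpoly.
  case: (leqP j m) => lejm; last by rewrite nth_default ?size_tuple.
  rewrite nth_fvec //; apply/eqP; rewrite pnatr_eq0 cards_eq0.
  apply/eqP/setP => G; rewrite !inE.
  apply/negP => /andP[/leq_fs_size + /eqP EG].
  by rewrite EG leqNgt ltj.
rewrite ltnNge; apply/negP => /leq_sizeP /(_ _ (leqnn _)) /eqP.
rewrite coef_fpoly nth_fvec ?fs_size_le // pnatr_eq0 cards_eq0.
move=> /eqP/setP/(_ F).
by rewrite !inE FPhi EF eqxx.
Qed.

Lemma DS_systemP m (Phi : {set {set 'I_m}}) :
  DS_system Phi <->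
  reflsym 0 (fpoly (fvec Phi)) \/ reflsym 1 (fpoly (fvec Phi)).
Proof.
have [-> | Phi0] := eqVneq Phi finset.set0.
  split=> [_ | _]; last by left.
  left; have -> : fpoly (fvec (finset.set0 : {set {set 'I_m}})) = 0.
    apply/polyP=> i; rewrite coef_fpoly coef0.
    case: (leqP i m) => leim; last by rewrite nth_default ?size_tuple.
    rewrite nth_fvec //; apply/eqP; rewrite pnatr_eq0 cards_eq0.
    by apply/eqP/setP => G; rewrite !inE.
  by rewrite /reflsym comp_poly0 scaler0.
have szP := size_fpoly_fvec Phi0.
have P0 : fpoly (fvec Phi) != 0 by rewrite -size_poly_eq0 szP.
have -> : DS_system Phi <-> reflsym (fs_size Phi) (fpoly (fvec Phi)).
  rewrite -(hvec_symP _ (fs_size_le Phi)); split=> [[E|//]|]; last by right.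
  by rewrite E eqxx in Phi0.
(* Only the parity of d matters, and either symmetry of the nonzero F forces that parity. *)
rewrite -reflsym_odd; split; first by case: odd; [right | left].
by case=> /[dup] /(reflsym_sign P0); rewrite szP /= => <-.
Qed.

(** * Padding by zeros, and coordinates forced or left free by symmetry *)

Lemma eq_fpoly s t : nth 0%N s =1 nth 0%N t -> fpoly s = fpoly t.
Proof. by move=> E; apply/polyP => i; rewrite !coef_fpoly E. Qed.

Lemma nth_rcons0 s : nth 0%N (rcons s 0%N) =1 nth 0%N s.
Proof.
by move=> i; rewrite nth_rcons if_same; case: ltnP => // /(nth_default 0%N) ->.
Qed.

Lemma fpoly_rcons0 s : fpoly (rcons s 0%N) = fpoly s.
Proof. exact/eq_fpoly/nth_rcons0. Qed.

Lemma fpoly_cons c s : fpoly (c :: s) = c%:R%:P + fpoly (0%N :: s).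
Proof.
apply/polyP => i; rewrite coefD coefC !coef_fpoly.
by case: i => [|i] /=; rewrite ?addr0 ?add0r.
Qed.

(** Constants are fixed by the reflection, so they cancel when the sign is +1. *)
Lemma reflsym0_cons c s :
  reflsym 0 (fpoly (c :: s)) <-> reflsym 0 (fpoly (0%N :: s)).
Proof.
rewrite /reflsym expr0 !scale1r fpoly_cons comp_polyD comp_polyC.
by split=> [/addrI | <-].
Qed.

(** Only i = m contributes to the coefficient of s^m in F(-1 - s), which gives f_m = -f_m. *)
Lemma reflsym_top s m e : (size s <= m.+1)%N -> odd (e + m) ->
  reflsym e (fpoly s) -> nth 0%N s m = 0%N.
Proof.
move=> szs odd_em /(congr1 (fun p : {poly int} => p`_m)).
rewrite coef_fpoly coefZ (coef_comp_refl _ szs) big_ord_recr /= big1 => [|i _].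
  rewrite add0r binn mulr1 mulrCA -exprD -signr_odd odd_em expr1 mulrN1.
  rewrite !natz => E; lia.
by rewrite bin_small ?mulr0.
Qed.

(** Only i = m and i = m + 1 contribute to the coefficient of s^m, which gives f_m = -f_m + (m + 1)
    f_{m+1}. *)
Lemma reflsym_next s m e : (size s <= m.+2)%N -> odd (e + m) ->
  reflsym e (fpoly s) -> (2 * nth 0 s m = m.+1 * nth 0 s m.+1)%N.
Proof.
move=> szs odd_em /(congr1 (fun p : {poly int} => p`_m)).
rewrite coef_fpoly coefZ (coef_comp_refl _ szs) !big_ord_recr /= big1 => [|i _].
  rewrite add0r binn mulr1 binSn mulrDr.
  rewrite mulrCA -exprD -[_ ^+ (e + m)]signr_odd odd_em expr1 mulrN1.
  rewrite [X in _ + X]mulrCA [(-1) ^+ e * (_ * _)]mulrA -exprD addnS exprS.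
  rewrite -[_ ^+ (e + m)]signr_odd odd_em expr1 mulrNN mul1r.
  rewrite !natz => E; lia.
by rewrite bin_small ?mulr0.
Qed.

(** * Binomial bounds and the natural points of the polytopes *)

(** The index is not limited by the length of [s]: past its end [nth] gives 0, and entries past m
    are forced to vanish. Padding thus leaves the condition unchanged. *)
Definition bounded (m : nat) (s : seq nat) : Prop :=
  forall i, (nth 0%N s i <= 'C(m, i))%N.

Lemma bounded_tnth m k (f : k.-tuple nat) :
  (forall i : 'I_k, (tnth f i <= 'C(m, i))%N) <-> bounded m f.
Proof.
split=> [lef i | lef i]; last by rewrite (tnth_nth 0%N).
case: (ltnP i k) => [ltik | leki]; last by rewrite nth_default ?size_tuple.
by have := lef (Ordinal ltik); rewrite (tnth_nth 0%N).
Qed.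

Lemma bounded_cons m c s :
  bounded m (c :: s) <-> (c <= 1)%N /\ forall i, (nth 0%N s i <= 'C(m, i.+1))%N.
Proof.
split=> [les | [lec1 les] [|i] //=]; last by rewrite bin0.
by split=> [|i]; [have := les 0%N; rewrite bin0 | exact: (les i.+1)].
Qed.

Lemma bounded_rcons0 m s : bounded m (rcons s 0%N) <-> bounded m s.
Proof. by split=> les i; have := les i; rewrite nth_rcons0. Qed.

Lemma boundedS m s : bounded m s -> bounded m.+1 s.
Proof. by move=> les i; apply: leq_trans (les i) _; rewrite leq_bin2l. Qed.

Lemma natvec_bounded (R : realType) n s : (size s <= n.+1)%N ->
  (forall j : 'I_n.+1, 0 <= natvec R n.+1 s 0 j <= 'C(n, j)%:R) <-> bounded n s.
Proof.
move=> szs; split=> les i; last by rewrite mxE ler0n ler_nat les.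
case: (ltnP i n.+1) => [lti | lei]; last first.
  by rewrite nth_default ?(leq_trans szs).
by have := les (Ordinal lti); rewrite mxE ler0n ler_nat.
Qed.

Lemma Qf_natvec (R : realType) n s : (size s <= n.+1)%N ->
  Qf R n (natvec R n.+1 s) <-> bounded n s /\ reflsym n (fpoly s).
Proof.
move=> szs; rewrite -(natvec_bounded R szs) -(natvec_Dmx R szs) /Qf /=.
rewrite mulmxBr mulmx1; split=> [[/eqP] | [les ->]]; last by rewrite subrr.
by rewrite subr_eq0 => /eqP <-.
Qed.

Lemma Pf_natvec (R : realType) n s : (size s <= n)%N ->
  Pf R n (natvec R n.+1 (0%N :: s)) <->
  bounded n (0%N :: s) /\ reflsym n (fpoly (0%N :: s)).
Proof.
move=> szs; have {}szs : (size (0%N :: s) <= n.+1)%N by [].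
rewrite -(natvec_bounded R szs) -(natvec_Dmx R szs).
rewrite /Pf /Ef /=; split=> [[-> [_ les]] | [les ->]].
  split=> // -[[|j] ltj]; last exact: les.
  by rewrite mxE lexx ler0n.
by do !split=> //; rewrite mxE.
Qed.

(** * The generating function as a sum over the two symmetry classes *)

Definition reflset m e : set (m.+1.-tuple nat) :=
  [set f : m.+1.-tuple nat | bounded m f /\ reflsym e (fpoly f)].
Arguments reflset : clear implicits.

Definition mono m (s : seq nat) : {mpoly int[m.+1]} :=
  \prod_(i < m.+1) xvar m i ^+ nth 0%N s i.

Lemma finite_bounded m k : finite_set [set f : k.-tuple nat | bounded m f].
Proof.
(* [N] bounds every entry, so the set lies in the image under [h] of a finite function space. *)
pose N := (\max_(i < k) 'C(m, i))%N.
pose h (g : {ffun 'I_k -> 'I_N.+1}) : k.-tuple nat :=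
  [tuple (g i : nat) | i < k].
apply: (sub_finite_set _ (finite_image h (@finite_finset _ setT))) => f lef.
exists [ffun i => inord (tnth f i)] => //; apply: eq_from_tnth => i.
rewrite tnth_mktuple ffunE inordK // ltnS (leq_trans _ (leq_bigmax i)) //.
by rewrite (tnth_nth 0%N) lef.
Qed.

Lemma finite_reflset m e : finite_set (reflset m e).
Proof. by apply: sub_finite_set (finite_bounded m m.+1) => f []. Qed.

Lemma DS_genfunE m :
  DS_genfun m = -1 + \sum_(f \in reflset m 0) mono m f
                   + \sum_(f \in reflset m 1) mono m f.
Proof.
pose z : m.+1.-tuple nat := [tuple of nseq m.+1 0%N].
have nthz i : nth 0%N z i = 0%N by rewrite nth_nseq if_same.
have z_refl e : reflset m e z.
  split=> [i|]; first by rewrite nthz.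
  have -> : fpoly z = 0 by apply/polyP => i; rewrite coef_fpoly nthz coef0.
  by rewrite /reflsym comp_poly0 scaler0.
have mono_z : mono m z = 1 by rewrite /mono big1 // => i _; rewrite nthz.
(* Removing the zero vector from the second class cancels -1 and makes the two classes disjoint. *)
rewrite (fsbigD1 z (reflset m 1)) /=; [|exact: finite_reflset|exact: z_refl].
rewrite mono_z addrACA addNr add0r.
rewrite -fsbigU0 /=; last 3 first.
- exact: finite_reflset.
- exact/finite_setD/finite_reflset.
- move=> f [[_ fsym0] [[_ fsym1] fz]]; apply: fz.
  have fP0 : fpoly f = 0.
    apply/eqP/negP => /negP fP0.
    by have := reflsym_sign fP0 fsym0; rewrite -(reflsym_sign fP0 fsym1).
  apply: eq_from_tnth => i; rewrite !(tnth_nth 0%N) nthz.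
  by apply/eqP; rewrite -(eqr_nat int) -coef_fpoly fP0 coef0.
rewrite /DS_genfun; under eq_fsbigr do under eq_bigr do rewrite (tnth_nth 0%N).
apply: eq_fsbigl; apply/seteqP; split=> [f [Phi [/DS_systemP fsym <-]] | f fU].
  have [-> | /eqP Pz] := pselect (fvec Phi = z); first by left.
  case: fsym => fsym; [left | right]; split=> //.
  - exact/bounded_tnth/tnth_fvec_le.
  - split=> //; exact/bounded_tnth/tnth_fvec_le.
  - exact/eqP.
have [lef fsym] : bounded m f /\ (reflsym 0 (fpoly f) \/ reflsym 1 (fpoly f)).
  by case: fU => [[lef ?] | [[lef ?] _]]; split=> //; [left | right].
have /bounded_tnth/fvec_onto [Phi EPhi] := lef.
by exists Phi; split=> //; apply/DS_systemP; rewrite EPhi.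
Qed.

Lemma prod_rcons0 (K : comNzRingType) (x : nat -> K) n (s : seq nat) :
  size s = n ->
  \prod_(i < n.+1) x i ^+ nth 0%N (rcons s 0%N) i =
  \prod_(i < n) x i ^+ nth 0%N s i.
Proof.
move=> szs; under eq_bigr do rewrite nth_rcons0.
by rewrite big_ord_recr /= nth_default ?szs // mulr1.
Qed.

Lemma mono_cons m c s :
  mono m (c :: s) = xvar m 0 ^+ c * \prod_(i < m) xvar m i.+1 ^+ nth 0%N s i.
Proof. by rewrite /mono big_ord_recl; congr (_ * _). Qed.

(** The map [h] pads the coordinates other than f_0: it is the identity for m even and appends one
    zero for m odd. As f_0 <= 1 is free, the symmetric class is two copies of [B], giving the factor
    1 + x_0. *)
Lemma sum_reflset0 m (k : nat) (h : k.-tuple nat -> m.-tuple nat)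
    (B : set (k.-tuple nat)) : injective h ->
  (forall f : m.+1.-tuple nat, reflset m 0 f ->
     exists c b, f = [tuple of c :: h b]) ->
  (forall b, B b <-> reflset m 0 [tuple of 0%N :: h b]) ->
  \sum_(f \in reflset m 0) mono m f =
  (1 + xvar m 0) * \sum_(b \in B) \prod_(i < m) xvar m i.+1 ^+ nth 0%N (h b) i.
Proof.
move=> inj_h onto_h BE; pose hc c b : m.+1.-tuple nat := [tuple of c :: h b].
have inj_hc c : set_inj B (hc c).
  by move=> b b' _ _ /(congr1 val) [/val_inj/inj_h].
have -> : reflset m 0 = (hc 0%N @` B) `|` (hc 1%N @` B).
  have hcE c b : (c <= 1)%N -> B b <-> reflset m 0 (hc c b).
    move=> lec; rewrite BE /reflset /= !bounded_cons (reflsym0_cons c).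
    by split=> -[[_ ?]].
  apply/seteqP; split=> [f fsym | f [] [b /hcE Bb <-]]; try exact: Bb.
  have [c [b Ef]] := onto_h f fsym; rewrite {f}Ef in fsym *.
  have lec : (c <= 1)%N by case: fsym => /bounded_cons [].
  have Bb : B b by apply/(hcE c).
  by case: c lec {fsym} => [|[|//]] _; [left | right]; exists b.
have finB : finite_set B.
  have -> : B = hc 0%N @^-1` reflset m 0 by apply/seteqP; split=> b /BE.
  apply: finite_preimage (finite_reflset m 0) => b b' _ _.
  by move=> /(congr1 val) [/val_inj/inj_h].
rewrite fsbigU0 /=; last 3 first.
- exact: finite_image.
- exact: finite_image.
- by move=> f [[b _ <-] [b' _ /(congr1 val)]].
rewrite !fsbig_image //= mulrDl mul1r mulr_fsumr.
by congr (_ + _); apply: eq_fsbigr => b _;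
  rewrite mono_cons ?expr0 ?expr1 ?mul1r.
Qed.

(** * The even and odd cases *)

Lemma tuple_rconsE n (f : n.+1.-tuple nat) :
  exists g : n.-tuple nat, f = [tuple of rcons g (nth 0%N f n)].
Proof.
have szt : size (take n f) == n by rewrite size_takel ?size_tuple.
exists (Tuple szt); apply: val_inj => /=.
by rewrite -take_nth ?size_tuple // take_oversize ?size_tuple.
Qed.

Lemma cat_rcons0 s : s ++ [:: 0%N; 0%N] = rcons (rcons s 0%N) 0%N.
Proof. by rewrite -!cats1 -catA. Qed.

Lemma prod_tnth (K : comNzRingType) (x : nat -> K) n (g : n.-tuple nat) :
  \prod_(i < n) x i ^+ tnth g i = \prod_(i < n) x i ^+ nth 0%N g i.
Proof. by apply: eq_bigr => i _; rewrite (tnth_nth 0%N). Qed.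

Lemma genfun_even (R : realType) (m : nat) : ~~ odd m ->
    DS_genfun m =
      - 1
      + (1 + xvar m 0) *
        (\sum_(b \in [set b : m.-tuple nat |
                       Pf R m (natvec R m.+1 (0%N :: b))])
            \prod_(i < m) xvar m i.+1 ^+ tnth b i)
      + \sum_(g \in [set g : m.-tuple nat |
                      Qf R m.+1 (natvec R m.+2 (g ++ [:: 0%N; 0%N])) /\
                      forall i : 'I_m, (tnth g i <= 'C(m, i))%N])
            \prod_(i < m) xvar m i ^+ tnth g i.
Proof.
move=> ev_m; rewrite DS_genfunE; congr (_ + _ + _).
  rewrite (@sum_reflset0 m m id [set b | Pf R m (natvec R m.+1 (0%N :: b))]) //.
  - congr (_ * _); apply: eq_fsbigr => b _.
    by rewrite (prod_tnth (fun i => xvar m i.+1)).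
  - move=> f _; by have [c b] := tupleP f; exists c, b.
  - move=> b /=; rewrite Pf_natvec ?size_tuple // -reflsym_odd (negbTE ev_m).
    by rewrite /reflset.
pose h (g : m.-tuple nat) : m.+1.-tuple nat := [tuple of rcons g 0%N].
set G := [set g | _].
(* Since m + 1 is odd, Q^f(m+1) encodes antisymmetry. One padding zero is f_m; the other is the
   extra coordinate of dimension m + 1. *)
have GE g : G g <-> reflset m 1 (h g).
  rewrite /G /= cat_rcons0 Qf_natvec ?size_rcons ?size_tuple //.
  rewrite !bounded_rcons0 !fpoly_rcons0 -reflsym_odd /= ev_m bounded_tnth.
  rewrite /reflset /= bounded_rcons0 fpoly_rcons0.
  (* The box for m is contained in the box for m + 1. *)
  by split=> [[[_ ?] ?] | [? ?]] //; split=> //; split=> //; apply: boundedS.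
have -> : reflset m 1 = h @` G.
  apply/seteqP; split=> [f fsym | f [g /GE ? <- //]].
  have [g Ef] := tuple_rconsE f; have [_ fsym1] := fsym.
  rewrite (reflsym_top (m := m) _ _ fsym1) ?size_tuple // in Ef.
  by exists g; [apply/GE; rewrite /h -Ef | rewrite /h -Ef].
rewrite fsbig_image => [|g g' _ _ /(congr1 val)/=/rcons_inj[/val_inj]//].
apply: eq_fsbigr => g _.
by rewrite /mono /= (@prod_rcons0 _ (xvar m)) ?size_tuple // prod_tnth.
Qed.

(** The odd case with m + 1 in place of m, so that the tuples of length m - 1 become tuples of
    length m. *)
Lemma genfun_odd (R : realType) (m : nat) : odd m.+1 ->
    DS_genfun m.+1 =
      - 1
      + \sum_(b \in [set b : m.-tuple nat |
                      Qf R m.+1 (natvec R m.+2 (b ++ [:: 0%N; 0%N]))])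
            \prod_(i < m) xvar m.+1 i ^+ tnth b i
      + (1 + xvar m.+1 0) *
        (\sum_(g \in [set g : m.-tuple nat |
                       Pf R m.+2 (natvec R m.+3 (0%N :: g ++ [:: 0%N; 0%N])) /\
                       forall i : 'I_m, (tnth g i <= 'C(m.+1, i.+1))%N])
            \prod_(i < m) xvar m.+1 i.+1 ^+ tnth g i).
Proof.
move=> od_m; rewrite DS_genfunE addrAC; congr (_ + _ + _).
  pose h (g : m.-tuple nat) : m.+2.-tuple nat :=
    [tuple of rcons (rcons g 0%N) 0%N].
  set G := [set g | _].
  have GE g : G g <-> reflset m.+1 1 (h g).
    rewrite /G /= cat_rcons0 Qf_natvec ?size_rcons ?size_tuple //.
    by rewrite /reflset /= -reflsym_odd od_m.
  have -> : reflset m.+1 1 = h @` G.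
    apply/seteqP; split=> [f fsym | f [g /GE ? <- //]].
    have [lef fsym1] := fsym.
    have f2 := reflsym_next (m := m) _ _ fsym1.
    rewrite size_tuple in f2; have {}f2 := f2 (leqnn _) od_m.
    (* The bound gives f_{m+1} <= 1, and the value 1 would make 2 f_m equal to the odd number m +
       1. *)
    have ftop : nth 0%N f m.+1 = 0%N.
      have := lef m.+1; rewrite binn; case: (nth _ _ m.+1) f2 => [|[|//]] //.
      by rewrite muln1 => /(congr1 odd); rewrite oddM od_m.
    have fnext : nth 0%N f m = 0%N by move: f2; rewrite ftop; lia.
    have [g' Ef] := tuple_rconsE f; have [g Eg] := tuple_rconsE g'.
    have gm : nth 0%N g' m = 0%N.
      by move: fnext; rewrite Ef /= nth_rcons size_tuple ltnS leqnn.
    rewrite ftop Eg gm in Ef.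
    by exists g; [apply/GE; rewrite /h -Ef | rewrite /h -Ef].
  rewrite fsbig_image => [|g g' _ _]; last first.
    by move=> /(congr1 val)/=/rcons_inj[/rcons_inj[/val_inj]].
  apply: eq_fsbigr => g _; rewrite /mono /= !(@prod_rcons0 _ (xvar m.+1)) //.
  - by rewrite prod_tnth.
  - by rewrite size_tuple.
  - by rewrite size_rcons size_tuple.
pose h (g : m.-tuple nat) : m.+1.-tuple nat := [tuple of rcons g 0%N].
set G := [set g | _].
rewrite (@sum_reflset0 _ _ h G).
- congr (_ * _); apply: eq_fsbigr => g _ /=.
  rewrite (prod_tnth (fun i => xvar m.+1 i.+1)).
  by rewrite (@prod_rcons0 _ (fun i => xvar m.+1 i.+1)) ?size_tuple.
- by move=> g g' /(congr1 val)/=/rcons_inj[/val_inj].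
- move=> f fsym; have [_ fsym0] := fsym.
  (* The sign +1 differs from (-1)^(m+1), so the top coordinate vanishes. *)
  have ftop := reflsym_top (m := m.+1) _ _ fsym0.
  rewrite size_tuple in ftop; have {}ftop := ftop (leqnn _) od_m.
  case/tupleP: f {fsym fsym0} ftop => c b /= ftop.
  have [g Eb] := tuple_rconsE b; exists c, g; rewrite /h.
  by apply: val_inj; rewrite /= {1}Eb ftop.
(* Dimension m + 2 is even, so P^f(m+2) encodes the sign +1; its two final zeros are f_{m+1} and the
   extra coordinate. *)
- move=> g; rewrite /G /= cat_rcons0 Pf_natvec ?size_rcons ?size_tuple //.
  rewrite /reflset /= -!rcons_cons !bounded_rcons0 !fpoly_rcons0.
  have -> : reflsym m.+2 (fpoly (0%N :: g)) <-> reflsym 0 (fpoly (0%N :: g)).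
    by rewrite -reflsym_odd oddS od_m.
  split=> [[[_ ?] leg] | [leg ?]]; split=> //.
  - apply/bounded_cons; split=> // i.
    case: (ltnP i m) => [lti | lei]; last by rewrite nth_default ?size_tuple.
    by have := leg (Ordinal lti); rewrite (tnth_nth 0%N).
  - by split=> //; apply: boundedS.
  - by move=> i; rewrite (tnth_nth 0%N); have /bounded_cons[_] := leg; apply.
Qed.

Theorem proposition5p4 (R : realType) (m : nat) (hm : (2 <= m)%N) :
  (~~ odd m ->
    DS_genfun m =
      - 1
      + (1 + xvar m 0) *
        (\sum_(b \in [set b : m.-tuple nat |
                       Pf R m (natvec R m.+1 (0%N :: b))])
            \prod_(i < m) xvar m i.+1 ^+ tnth b i)
      + \sum_(g \in [set g : m.-tuple nat |
                      Qf R m.+1 (natvec R m.+2 (g ++ [:: 0%N; 0%N])) /\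
                      forall i : 'I_m, (tnth g i <= 'C(m, i))%N])
            \prod_(i < m) xvar m i ^+ tnth g i)
  /\
  (odd m ->
    DS_genfun m =
      - 1
      + \sum_(b \in [set b : (m.-1).-tuple nat |
                      Qf R m (natvec R m.+1 (b ++ [:: 0%N; 0%N]))])
            \prod_(i < m.-1) xvar m i ^+ tnth b i
      + (1 + xvar m 0) *
        (\sum_(g \in [set g : (m.-1).-tuple nat |
                       Pf R m.+1 (natvec R m.+2 (0%N :: g ++ [:: 0%N; 0%N])) /\
                       forall i : 'I_m.-1, (tnth g i <= 'C(m, i.+1))%N])
            \prod_(i < m.-1) xvar m i.+1 ^+ tnth g i)).
Proof.
split; first exact: genfun_even.
by case: m hm => // m _; apply: genfun_odd.
Qed.
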